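(* Let $a,b\in A$ and $\mathsf{r}\in\mathsf{Reg}$. If $\vdash_A\{a\}\ \mathsf{r}\ \{b\}$ is derivable in $\mathrm{APPL}_A$, then $[\![\mathsf{r}]\!]\gamma(a)\sqsubseteq\gamma(b)$, and consequently $\vdash\{\gamma(a)\}\ \mathsf{r}\ \{\gamma(b)\}$ holds.
   Context: Fix an interpretation monoid $(D,\sqsubseteq,\oplus,\mathcal{B}_D)$: $(D,\sqsubseteq,\oplus)$ is an ordered complete monoid (an infinitary, infinitarily associative, monotone sum $\bigoplus_{i\in I}$ with neutral element $0_\oplus$), $(D,\sqsubseteq)$ is a complete lattice, $\mathcal{B}_D$ is a pointed join basis ($\bot\in\mathcal{B}_D$, every $d=\bigsqcup\{b\in\mathcal{B}_D\mid b\sqsubseteq d\}$), and the submonoid generated by $\mathcal{B}_D$ is a $\kappa_D$-quantale. Regular commands $\mathsf{r}::=\mathsf{e}\mid\mathsf{r};\mathsf{r}\mid\mathsf{r}+\mathsf{r}\mid\mathsf{r}^*$ have basis semantics $[\![\cdot]\!]_B$ on $\mathcal{B}_D$ (given monotone on elementary commands; $[\![\mathsf{r}_1;\mathsf{r}_2]\!]_B b=\bigsqcup\{[\![\mathsf{r}_2]\!]_B b'\mid b'\in\mathcal{B}_D, b'\sqsubseteq[\![\mathsf{r}_1]\!]_B b\}$, $[\![\mathsf{r}_1+\mathsf{r}_2]\!]_B b=[\![\mathsf{r}_1]\!]_B b\oplus[\![\mathsf{r}_2]\!]_B b$, $[\![\mathsf{r}^*]\!]_B b=\bigoplus_{i\ge0}[\![\mathsf{r}^i]\!]_B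 b$) and full semantics $[\![\mathsf{r}]\!]d=\bigsqcup\{[\![\mathsf{r}]\!]_B b\mid b\in\mathcal{B}_D, b\sqsubseteq d\}$. The concrete logic APPL (with $\vdash$) over assertions in $D$ has rules (basic), (seq), (cons), (choice), (iter), (rec), (inv), (join), (meet): (basic) $[\![\mathsf{e}]\!]h\sqsubseteq k\Rightarrow\vdash\{h\}\mathsf{e}\{k\}$; (seq) from $\{h\}\mathsf{r}_1\{k'\}$, $\{k'\}\mathsf{r}_2\{k\}$ infer $\{h\}\mathsf{r}_1;\mathsf{r}_2\{k\}$; (cons) weaken pre / strengthen post along $\sqsubseteq$; (choice) from $\{h\}\mathsf{r}_1\{k_1\}$, $\{h\}\mathsf{r}_2\{k_2\}$, $k_1\oplus k_2\sqsubseteq k$ infer $\{h\}\mathsf{r}_1+\mathsf{r}_2\{k\}$; (iter) from $\{h_i\}\mathsf{r}\{h_{i+1}\}$ for all $i\in\mathbb{N}$ and $\bigoplus_i h_i\sqsubseteq k$ infer $\{h_0\}\mathsf{r}^*\{k\}$; (rec) from $\{h\}\mathsf{r}\{k'\}$, $\{k'\}\mathsf{r}^*\{l\}$, $h\oplus l\sqsubseteq k$ infer $\{h\}\mathsf{r}^*\{k\}$; (inv) from $\{h\}\mathsf{r}\{k'\}$, $k'\sqsubseteq h$, $\bigoplus_{\mathbb{N}}h\sqsubseteq k$ infer $\{h\}\mathsf{r}^*\{k\}$; (join) from $\{h_i\}_{i\in\mathbb{N}}$ dense (every $b\in\mathcal{B}_D$ below $\bigsqcup_i h_i$ is below some $h_i$),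 $h\sqsubseteq\bigsqcup_i h_i$, $\{h_i\}\mathsf{r}\{k_i\}$, $\bigsqcup_i k_i\sqsubseteq k$ infer $\{h\}\mathsf{r}\{k\}$; (meet) from $h\sqsubseteq\sqcap_{i\in\mathbb{N}}h_i$ (greatest lower bound), $\{h_i\}\mathsf{r}\{k_i\}$, $\sqcap_{i\in\mathbb{N}}k_i\sqsubseteq k$ infer $\{h\}\mathsf{r}\{k\}$. Let $D\rightleftarrows A$ be a Galois insertion with abstraction $\alpha:D\to A$ (additive, surjective) and concretization $\gamma:A\to D$ (injective), $\alpha(h)\sqsubseteq_A a\iff h\sqsubseteq\gamma(a)$. The best correct approximation of $f:D^n\to D$ is $f^A(a_1,\dots,a_n)=\alpha(f(\gamma(a_1),\dots,\gamma(a_n)))$. The abstract logic $\mathrm{APPL}_A$ (derivability $\vdash_A$, assertions in $A$) is obtained from the APPL rules by replacing $\sqsubseteq$ with $\sqsubseteq_A$; the join, meet, $\oplus$ and the basis semantics of elementary commands with their best correct approximations in $A$ (in rule (basic), $[\![\mathsf{e}]\!]^A a$ is the abstract join of $[\![\mathsf{e}]\!]^A_B b$ over $b\in\alpha(\mathcal{B}_D)$ with $b\sqsubseteq_A a$); and in rule (join) density is taken wrt the abstract basis $\alpha(\mathcal{B}_D)$.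
   Formalization: Elementary commands are assumed to send basis elements into the submonoid generated by the basis, and ''κ-quantale'' is read as: infinite sums commute with nonempty joins of size ≤ κ taken simultaneously in all summands; without these, rule (rec) is unsound. *)

(* Defs.v *)
From HB Require Import structures.
From mathcomp Require Import all_boot all_order.
From mathcomp Require Import boolp classical_sets functions cardinality.

Set Implicit Arguments.
Unset Strict Implicit.
Unset Printing Implicit Defensive.

Import Order.Theory.

Local Open Scope classical_set_scope.
Local Open Scope order_scope.
Local Open Scope card_scope.

Record is_complete_lattice d (T : porderType d) (join meet : set T -> T) :
  Prop := IsCompleteLattice {
  joinP : forall X : set T, supremums X (join X);
  meetP : forall X : set T, infimums X (meet X)
}.

(* The infinitary sum is a function on families over arbitrary index types.
   [bigplus_partition] is infinitary associativity: blocks may be empty, and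
   with [bigplus_single] it yields invariance under reindexing along
   bijections and neutrality of the empty sum.  Monotonicity gives
   extensionality in the family. *)
Record is_ordered_complete_monoid d (T : porderType d)
    (bigplus : forall I : Type, (I -> T) -> T) : Prop :=
  IsOrderedCompleteMonoid {
  bigplus_single : forall (I : Type) (i0 : I) (x : I -> T),
    (forall i, i = i0) -> bigplus I x = x i0;
  bigplus_partition : forall (I J : Type) (f : I -> J) (x : I -> T),
    bigplus I x =
    bigplus J (fun j => bigplus {i : I | f i = j} (fun i => x (sval i)));
  bigplus_mono : forall (I : Type) (x y : I -> T),
    (forall i, x i <= y i) -> bigplus I x <= bigplus I y
}.

Definition plus_of (T : Type) (bigplus : forall I : Type, (I -> T) -> T)
    (x y : T) : T :=
  bigplus bool (fun c => if c then x else y).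

Record is_pointed_join_basis d (T : porderType d) (join : set T -> T)
    (B : set T) : Prop := IsPointedJoinBasis {
  basis_bot : B (join set0);
  basis_join : forall x : T, x = join [set b | B b /\ b <= x]
}.

(* Submonoid of a complete monoid: closed under all sums, in particular under
   the empty one. *)
Inductive gen_submonoid (T : Type) (bigplus : forall I : Type, (I -> T) -> T)
    (B : set T) : set T :=
| gen_base x : B x -> gen_submonoid bigplus B x
| gen_bigplus (I : Type) (x : I -> T) :
    (forall i, gen_submonoid bigplus B (x i)) ->
    gen_submonoid bigplus B (bigplus I x).

(* The cardinal kappa is represented by a type [K].  A submonoid [Q] is a
   kappa-quantale when it is closed under joins of nonempty families of size at
   most kappa, and the infinitary sum, as a function of the whole family of its
   summands, preserves such joins:
     (+)_i \/_j x_ij = \/_j (+)_i x_ij.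
   Distributivity in each summand separately would be too weak: it does not
   make the unfolding rule for iteration sound.
   Empty families are excluded, since 0 need not be the bottom element and
   the bottom element need not be absorbing. *)
Record is_kappa_quantale d (T : porderType d) (join : set T -> T)
    (bigplus : forall I : Type, (I -> T) -> T) (K : Type) (Q : set T) : Prop :=
  IsKappaQuantale {
  quantale_join : forall (J : Type) (x : J -> T),
    [set: J] !=set0 -> [set: J] #<= [set: K] ->
    (forall j, Q (x j)) -> Q (join (range x));
  quantale_distr : forall (I J : Type) (x : I -> J -> T),
    [set: J] !=set0 -> [set: J] #<= [set: K] ->
    (forall i j, Q (x i j)) ->
    bigplus I (fun i => join (range (x i))) =
    join (range (fun j => bigplus I (fun i => x i j)))
}.

(* kappa bounds the number of basis elements needed to dominate all those
   below a given element of [Q].  For instance kappa = 1 for singletons of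
   sets in a powerset of a powerset, although the bottom element also lies
   below each of them. *)
Definition basis_bound d (T : porderType d) (B : set T) (K : Type) (Q : set T) :=
  forall x, Q x -> exists C : set T,
    [/\ C #<= [set: K],
        forall c, C c -> B c /\ c <= x &
        forall b, B b -> b <= x -> exists2 c, C c & b <= c].

Record interpMonoid (d : Order.disp_t) := InterpMonoid {
  im_sort :> porderType d;
  im_join : set im_sort -> im_sort;
  im_meet : set im_sort -> im_sort;
  im_bigplus : forall I : Type, (I -> im_sort) -> im_sort;
  im_basis : set im_sort;
  im_kappa : Type;
  im_lattice : is_complete_lattice im_join im_meet;
  im_monoid : is_ordered_complete_monoid im_bigplus;
  im_basisP : is_pointed_join_basis im_join im_basis;
  im_bound : basis_bound im_basis im_kappa
               (gen_submonoid im_bigplus im_basis);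
  im_quantale : is_kappa_quantale im_join im_bigplus im_kappa
                  (gen_submonoid im_bigplus im_basis)
}.
Arguments im_bigplus {d} i I x.

Inductive Reg (E : Type) : Type :=
| Elem of E
| Seq of Reg E & Reg E
| Choice of Reg E & Reg E
| Star of Reg E.

Section Semantics.
Variables (d : Order.disp_t) (D : interpMonoid d) (E : Type).
(* Functions on the basis are represented by functions on [D] whose values
   outside the basis are never used. *)
Variable esem : E -> D -> D.

Definition valid_esem : Prop :=
  (forall e b, im_basis b ->
     gen_submonoid (@im_bigplus d D) (@im_basis d D) (esem e b)) /\
  (forall e b b', im_basis b -> im_basis b' -> b <= b' -> esem e b <= esem e b').

(* Extension by additivity of a function on the basis. *)
Definition basis_lift (f : D -> D) (x : D) : D :=
  im_join (f @` [set b | im_basis b /\ b <= x]).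

Definition seq_sem (f g : D -> D) (b : D) : D := basis_lift g (f b).

(* [r^0] is the identity on the basis, and r^(i+1) = r ; r^i. *)
Fixpoint pow_sem (f : D -> D) (n : nat) : D -> D :=
  if n is n'.+1 then seq_sem f (pow_sem f n') else id.

Fixpoint bsem (r : Reg E) : D -> D :=
  match r with
  | Elem e => esem e
  | Seq r1 r2 => seq_sem (bsem r1) (bsem r2)
  | Choice r1 r2 =>
      fun b => plus_of (@im_bigplus d D) (bsem r1 b) (bsem r2 b)
  | Star r1 => fun b => im_bigplus D nat (fun i => pow_sem (bsem r1) i b)
  end.

Definition sem (r : Reg E) : D -> D := basis_lift (bsem r).

End Semantics.

(* The rules are parametric in the operations on assertions: the concrete and
   the abstract logic are both instances.  [esem] is the full (not only
   basis) semantics of elementary commands. *)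
Section Logic.
Variables (d : Order.disp_t) (T : porderType d).
Variables (join meet : set T -> T) (bigplus : forall I : Type, (I -> T) -> T).
Variables (B : set T) (E : Type) (esem : E -> T -> T).

Definition dense (h : nat -> T) : Prop :=
  forall b, B b -> b <= join (range h) -> exists i, b <= h i.

Inductive derivable : T -> Reg E -> T -> Prop :=
| rule_basic h e k : esem e h <= k -> derivable h (Elem e) k
| rule_seq h k' k r1 r2 :
    derivable h r1 k' -> derivable k' r2 k -> derivable h (Seq r1 r2) k
| rule_cons h h' k k' r :
    h <= h' -> derivable h' r k' -> k' <= k -> derivable h r k
| rule_choice h k1 k2 k r1 r2 :
    derivable h r1 k1 -> derivable h r2 k2 -> plus_of bigplus k1 k2 <= k ->
    derivable h (Choice r1 r2) k
| rule_iter (h : nat -> T) k r :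
    (forall i, derivable (h i) r (h i.+1)) -> bigplus h <= k ->
    derivable (h 0%N) (Star r) k
| rule_rec h k' l k r :
    derivable h r k' -> derivable k' (Star r) l -> plus_of bigplus h l <= k ->
    derivable h (Star r) k
| rule_inv h k' k r :
    derivable h r k' -> k' <= h -> bigplus (fun _ : nat => h) <= k ->
    derivable h (Star r) k
| rule_join (hs ks : nat -> T) h k r :
    dense hs -> h <= join (range hs) ->
    (forall i, derivable (hs i) r (ks i)) -> join (range ks) <= k ->
    derivable h r k
| rule_meet (hs ks : nat -> T) h k r :
    h <= meet (range hs) ->
    (forall i, derivable (hs i) r (ks i)) -> meet (range ks) <= k ->
    derivable h r k.

End Logic.

Definition appl d (D : interpMonoid d) (E : Type) (esem : E -> D -> D) :
    D -> Reg E -> D -> Prop :=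
  derivable (@im_join d D) (@im_meet d D) (@im_bigplus d D) (@im_basis d D)
    (fun e => sem esem (Elem e)).

(* Additivity of [alpha] follows from the adjunction. *)
Record galois_insertion d d' (D : porderType d) (A : porderType d')
    (alpha : D -> A) (gamma : A -> D) : Prop := GaloisInsertion {
  galois_adj : forall x a, alpha x <= a <-> x <= gamma a;
  galois_surj : forall a, exists x, alpha x = a;
  galois_inj : injective gamma
}.

(* Best correct approximations of the operations of [D]. *)
Section Abstract.
Variables (d d' : Order.disp_t) (D : interpMonoid d) (A : porderType d').
Variables (alpha : D -> A) (gamma : A -> D).
Variables (E : Type) (esem : E -> D -> D).

Definition abs_join (X : set A) : A := alpha (im_join (gamma @` X)).
Definition abs_meet (X : set A) : A := alpha (im_meet (gamma @` X)).
Definition abs_bigplus (I : Type) (x : I -> A) : A :=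
  alpha (im_bigplus D I (fun i => gamma (x i))).
Definition abs_basis : set A := alpha @` (@im_basis d D).

(* [gamma b] need not be a basis element, so the approximation goes through
   the full semantics, which extends the basis one. *)
Definition abs_bsem (e : E) (b : A) : A := alpha (sem esem (Elem e) (gamma b)).

Definition abs_sem (e : E) (a : A) : A :=
  abs_join (abs_bsem e @` [set b | abs_basis b /\ b <= a]).

Definition appl_abs : A -> Reg E -> A -> Prop :=
  derivable abs_join abs_meet abs_bigplus abs_basis abs_sem.

End Abstract.

(* Main.v *)
Require Import Defs.
From mathcomp Require Import all_boot all_order.
From mathcomp Require Import boolp classical_sets functions cardinality.

(** Concretizing every assertion turns an [APPL_A] derivation into an [APPL]
    derivation, rule by rule: each side condition transfers along the
    adjunction, and density with respect to [alpha @` B] is exactly what makes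
    the concretized premises of (join) dense, and their concrete join, which may
    lie below the concretization of the abstract one, still above
    [gamma h].  It then remains to see that [APPL] is sound.  The only delicate
    rule is (rec), that is, the unfolding of [r^*], where the infinite sum has
    to be exchanged with the join over the basis elements below
    [bsem esem r b]; this join may be restricted to kappa elements, so the
    quantale law applies. *)

Import Order.Theory.

Local Open Scope classical_set_scope.
Local Open Scope card_scope.
Local Open Scope order_scope.

Section InterpMonoidTheory.
Context {d : Order.disp_t} {D : interpMonoid d}.

Local Notation sub := (gen_submonoid (@im_bigplus d D) (@im_basis d D)).

(** * Lattice and infinitary sum *)

Lemma join_ub (X : set D) x : X x -> x <= im_join X.
Proof. by case: (joinP (im_lattice D) X) => ub _; apply: ub. Qed.

Lemma join_lub (X : set D) y : (forall x, X x -> x <= y) -> im_join X <= y.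
Proof. by case: (joinP (im_lattice D) X) => _ lb Xy; apply: lb. Qed.

Lemma meet_lb (X : set D) x : X x -> im_meet X <= x.
Proof. by case: (meetP (im_lattice D) X) => lb _; apply: lb. Qed.

Lemma meet_glb (X : set D) y : (forall x, X x -> y <= x) -> y <= im_meet X.
Proof. by case: (meetP (im_lattice D) X) => _ ub Xy; apply: ub. Qed.

Lemma basis_le (x y : D) :
  (forall b, im_basis b -> b <= x -> b <= y) -> x <= y.
Proof.
move=> xy; rewrite [x](basis_join (im_basisP D)).
by apply: join_lub => b [Bb bx]; exact: xy.
Qed.

(** Partitioning along [g] gives fibres with exactly one element, on which the sum is trivial. *)
Lemma bigplus_reindex (I J : Type) (g : I -> J) (h : J -> I) (x : J -> D) :
  cancel g h -> cancel h g ->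
  im_bigplus D I (fun i => x (g i)) = im_bigplus D J x.
Proof.
move=> gK hK; rewrite (bigplus_partition (im_monoid D) g); congr (im_bigplus D J).
apply/funext => j.
rewrite (bigplus_single (im_monoid D) (i0 := exist _ (h j) (hK j))) /= ?hK //.
by move=> [i gi]; apply: eq_exist; rewrite /= -gi gK.
Qed.

Lemma bigplus_natS (x : nat -> D) :
  im_bigplus D nat x =
  plus_of (@im_bigplus d D) (x 0%N) (im_bigplus D nat (fun i => x i.+1)).
Proof.
rewrite (bigplus_partition (im_monoid D) (fun i => i == 0%N)) /plus_of.
congr (im_bigplus D bool); apply/funext => -[].
  rewrite (bigplus_single (im_monoid D) (i0 := exist _ 0%N (eqxx 0%N))) //.
  by move=> [i i0]; apply: eq_exist; apply/eqP.
(* The block of nonzero indices is reindexed by the successor, whose inverse there is the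
   predecessor. *)
pose g (i : nat) : {i | (i == 0%N) = false} := exist _ i.+1 erefl.
rewrite -(@bigplus_reindex _ _ g (fun i => (sval i).-1)) // => -[i i0].
by apply: eq_exist; case: i i0.
Qed.

Lemma plus_of_mono (x x' y y' : D) : x <= x' -> y <= y' ->
  plus_of (@im_bigplus d D) x y <= plus_of (@im_bigplus d D) x' y'.
Proof. by move=> xx' yy'; apply: (bigplus_mono (im_monoid D)) => -[]. Qed.

(** * Extension of functions from the basis *)

Definition basis_mono (f : D -> D) :=
  forall b b', im_basis b -> im_basis b' -> b <= b' -> f b <= f b'.

(** The kappa bound and the quantale laws hold only on the generated submonoid, so values have to be
    tracked there. *)
Definition basis_sub (f : D -> D) := forall b, im_basis b -> sub (f b).

Lemma basis_lift_mono (f : D -> D) x y :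
  x <= y -> basis_lift f x <= basis_lift f y.
Proof.
move=> xy; apply: join_lub => _ [b [Bb bx] <-].
by apply: join_ub; exists b => //; split=> //; exact: le_trans xy.
Qed.

Lemma basis_lift_ge (f : D -> D) b x :
  im_basis b -> b <= x -> f b <= basis_lift f x.
Proof. by move=> Bb bx; apply: join_ub; exists b. Qed.

Lemma basis_lift_le (f : D -> D) x y :
  (forall b, im_basis b -> b <= x -> f b <= y) -> basis_lift f x <= y.
Proof. by move=> fy; apply: join_lub => _ [b [Bb bx] <-]; exact: fy. Qed.

(* The index type is chosen before [f], so that the same one serves all the
   summands of an infinite sum. *)
Lemma basis_lift_small x : sub x -> exists C : set D,
  [/\ [set: set_type C] !=set0, [set: set_type C] #<= [set: im_kappa D],
      forall c, C c -> im_basis c /\ c <= x &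
      forall f, basis_mono f ->
        basis_lift f x = im_join (range (fun c : set_type C => f (val c)))].
Proof.
move=> /(im_bound (i := D)) [C [Ck CB CX]]; exists C; split => //.
(* The bottom element is a basis element below [x], so some member of [C] dominates it. The quantale
   laws require this nonemptiness. *)
- have [||c Cc _] := CX (im_join set0); first exact: basis_bot (im_basisP D).
    by apply: join_lub.
  by exists (SigSub (mem_set Cc)).
- by apply: (card_le_trans _ Ck); have := card_setT C; rewrite card_eq_le => /andP[].
- move=> f fM; apply/le_anti/andP; split.
    apply: basis_lift_le => b Bb bx; have [c Cc bc] := CX b Bb bx.
    apply: (le_trans (fM _ _ Bb (CB c Cc).1 bc)).
    by apply: join_ub; exists (SigSub (mem_set Cc)).
  apply: join_lub => _ [c _ <-].
  by have [Bc cx] := CB _ (set_mem (valP c)); exact: basis_lift_ge.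
Qed.

Lemma basis_lift_sub f x :
  basis_mono f -> basis_sub f -> sub x -> sub (basis_lift f x).
Proof.
move=> fM fS /basis_lift_small [C [C0 Ck CB ->]] //.
apply: (quantale_join (im_quantale D)) => // c.
by apply: fS; have [] := CB _ (set_mem (valP c)).
Qed.

Lemma seq_sem_mono f g : basis_mono f -> basis_mono (seq_sem f g).
Proof. by move=> fM b b' Bb Bb' bb'; apply: basis_lift_mono; exact: fM. Qed.

Lemma seq_sem_sub f g :
  basis_sub f -> basis_mono g -> basis_sub g -> basis_sub (seq_sem f g).
Proof. by move=> fS gM gS b Bb; apply: basis_lift_sub => //; exact: fS. Qed.

Lemma pow_sem_mono f n : basis_mono f -> basis_mono (pow_sem f n).
Proof. by case: n => [|n] fM //=; exact: seq_sem_mono. Qed.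

Lemma pow_sem_sub f n : basis_mono f -> basis_sub f -> basis_sub (pow_sem f n).
Proof.
move=> fM fS; elim: n => [|n IH] /=; first by move=> b Bb; exact: gen_base.
by apply: seq_sem_sub => //; exact: pow_sem_mono.
Qed.

(** A single small set [C] computes the lifts of all the [f i] and of their sum, so the quantale law
    applies with [C] as the common index of the joins. *)
Lemma bigplus_basis_lift (I : Type) (f : I -> D -> D) x :
  sub x -> (forall i, basis_mono (f i)) -> (forall i, basis_sub (f i)) ->
  im_bigplus D I (fun i => basis_lift (f i) x) =
  basis_lift (fun b => im_bigplus D I (fun i => f i b)) x.
Proof.
move=> /basis_lift_small [C [C0 Ck CB liftE]] fM fS.
rewrite liftE; last first.
  by move=> b b' Bb Bb' bb'; apply: (bigplus_mono (im_monoid D)) => i; exact: fM.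
rewrite -(quantale_distr (im_quantale D) (x := fun i c => f i (val c))) //.
  by congr (im_bigplus D I); apply/funext => i; exact: liftE.
by move=> i c; apply: fS; have [] := CB _ (set_mem (valP c)).
Qed.

(** * Soundness of the concrete logic *)

Section Soundness.
Context {E : Type} {esem : E -> D -> D}.
Hypothesis esemP : valid_esem esem.

Lemma bsem_mono_sub r : basis_mono (bsem esem r) /\ basis_sub (bsem esem r).
Proof.
elim: r => [e|r1 [M1 S1] r2 [M2 S2]|r1 [M1 S1] r2 [M2 S2]|r [M S]] /=.
- by case: esemP => S M; split=> b; [exact: M | exact: S].
- by split; [exact: seq_sem_mono | exact: seq_sem_sub].
- split=> [b b' Bb Bb' bb'|b Bb]; first by apply: plus_of_mono; auto.
  by apply: gen_bigplus => -[]; auto.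
- split=> [b b' Bb Bb' bb'|b Bb].
    by apply: (bigplus_mono (im_monoid D)) => i; exact: pow_sem_mono.
  by apply: gen_bigplus => i; exact: pow_sem_sub.
Qed.

Lemma sem_mono r (x y : D) : x <= y -> sem esem r x <= sem esem r y.
Proof. exact: basis_lift_mono. Qed.

Lemma bsem_le_sem r b (x : D) :
  im_basis b -> b <= x -> bsem esem r b <= sem esem r x.
Proof. exact: basis_lift_ge. Qed.

Lemma bsem_star_unfold r b : im_basis b ->
  bsem esem (Star r) b =
  plus_of (@im_bigplus d D) b (sem esem (Star r) (bsem esem r b)).
Proof.
move=> Bb; have [M S] := bsem_mono_sub r.
rewrite /= bigplus_natS /=; congr plus_of.
(* With summand 0 split off, summand [i.+1] is the lift of the [i]-th power at [bsem esem r b]. *)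
apply: bigplus_basis_lift; first exact: S.
- by move=> i; exact: pow_sem_mono.
- by move=> i; exact: pow_sem_sub.
Qed.

(** The sums are compared termwise: the [i]-th power sends basis elements below [h 0] below [h i]. A
    constant [h] covers rule (inv). *)
Lemma sem_star_iter r (h : nat -> D) :
  (forall i, sem esem r (h i) <= h i.+1) ->
  sem esem (Star r) (h 0%N) <= im_bigplus D nat h.
Proof.
move=> hS; apply: basis_lift_le => b Bb bh.
apply: (bigplus_mono (im_monoid D)) => i.
(* Powers unfold on the left, so the induction is for all [h] and is applied to the shifted
   sequence. *)
elim: i h hS b Bb bh => [//|i IH] h hS b Bb bh /=.
apply: basis_lift_le => c Bc cb.
apply: (IH (fun i => h i.+1)) => //.
apply: (le_trans cb); apply: le_trans (hS 0%N); exact: bsem_le_sem.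
Qed.

Lemma appl_sound h r k : appl esem h r k -> sem esem r h <= k.
Proof.
elim=> {h r k} [h e k //|h k' k r1 r2 _ IH1 _ IH2|h h' k k' r hh' _ IH kk'
  |h k1 k2 k r1 r2 _ IH1 _ IH2 kk|h k r _ IH hk|h k' l k r _ IH1 _ IH2 hlk
  |h k' k r _ IH k'h hk|hs ks h k r dhs hhs _ IH ksk|hs ks h k r hhs _ IH ksk].
- apply: basis_lift_le => b Bb bh; apply: le_trans IH2.
  apply: basis_lift_mono; apply: le_trans IH1; exact: bsem_le_sem.
- by apply: le_trans kk'; apply: le_trans IH; exact: sem_mono.
- apply: basis_lift_le => b Bb bh; apply: le_trans kk.
  by apply: plus_of_mono; [apply: le_trans IH1|apply: le_trans IH2];
    exact: bsem_le_sem.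
- exact: le_trans (sem_star_iter _ _ IH) hk.
- apply: basis_lift_le => b Bb bh; rewrite bsem_star_unfold //.
  apply: le_trans hlk; apply: plus_of_mono => //.
  apply: le_trans IH2; apply: sem_mono.
  by apply: le_trans IH1; exact: bsem_le_sem.
- apply: le_trans hk; apply: (sem_star_iter _ (fun=> h)) => _.
  exact: le_trans k'h.
- apply: basis_lift_le => b Bb bh.
  (* [sem esem r] need not preserve joins; density places [b] below a single [hs i]. *)
  have [i bi] := dhs b Bb (le_trans bh hhs).
  apply: le_trans ksk; apply: le_trans (join_ub (range ks) (ks i) _); last by exists i.
  by apply: le_trans (IH i); exact: bsem_le_sem.
- apply: le_trans ksk; apply: meet_glb => _ [i _ <-].
  apply: le_trans (IH i); apply: sem_mono; apply: (le_trans hhs).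
  by apply: meet_lb; exists i.
Qed.

End Soundness.

(** * From abstract to concrete derivations *)

Section Concretization.
Context {d' : Order.disp_t} {A : porderType d'} {alpha : D -> A} {gamma : A -> D}.
Context {E : Type} {esem : E -> D -> D}.
Hypothesis galP : galois_insertion alpha gamma.

Lemma alpha_le x a : x <= gamma a -> alpha x <= a.
Proof. by move/(galois_adj galP). Qed.

Lemma le_gamma x a : alpha x <= a -> x <= gamma a.
Proof. by move/(galois_adj galP). Qed.

Lemma gamma_mono (a b : A) : a <= b -> gamma a <= gamma b.
Proof. by move=> ab; apply: le_gamma; apply: le_trans ab; exact: alpha_le. Qed.

Lemma gamma_range (xs : nat -> A) :
  gamma @` range xs = range (fun i => gamma (xs i)).
Proof. exact: image_comp. Qed.

Lemma plus_of_gamma (x y : A) :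
  plus_of (abs_bigplus alpha gamma) x y =
  alpha (plus_of (@im_bigplus d D) (gamma x) (gamma y)).
Proof.
rewrite /plus_of /abs_bigplus.
by under [X in im_bigplus D bool X]funext do rewrite fun_if.
Qed.

(** A basis element [b] below [gamma a] yields the abstract basis element [alpha b] below [a], which
    contributes to the abstract join; [b] itself lies below [gamma (alpha b)]. *)
Lemma sem_elem_gamma e (a : A) :
  sem esem (Elem e) (gamma a) <= gamma (abs_sem alpha gamma esem e a).
Proof.
apply: basis_lift_le => b Bb ba.
apply: (@le_trans _ _ (gamma (abs_bsem alpha gamma esem e (alpha b)))).
  by apply: le_trans (le_gamma _ _ (lexx _)); apply: bsem_le_sem => //; exact: le_gamma.
apply: le_trans (le_gamma _ _ (lexx _)); apply: join_ub.
exists (abs_bsem alpha gamma esem e (alpha b)) => //; exists (alpha b) => //.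
by split; [exists b | exact: alpha_le].
Qed.

Lemma appl_abs_gamma a r b :
  appl_abs alpha gamma esem a r b -> appl esem (gamma a) r (gamma b).
Proof.
elim=> {a r b} [h e k ek|h k' k r1 r2 _ IH1 _ IH2|h h' k k' r hh' _ IH kk'
  |h k1 k2 k r1 r2 _ IH1 _ IH2 kk|h k r _ IH hk|h k' l k r _ IH1 _ IH2 hlk
  |h k' k r _ IH k'h hk|hs ks h k r dhs hhs _ IH ksk|hs ks h k r hhs _ IH ksk].
- by apply: rule_basic; apply: le_trans (gamma_mono _ _ ek); exact: sem_elem_gamma.
- exact: rule_seq IH1 IH2.
- by apply: rule_cons IH _; exact: gamma_mono.
- by apply: (rule_choice IH1 IH2); apply: le_gamma; rewrite -plus_of_gamma.
- by apply: (rule_iter (h := fun i => gamma (h i))) => //; exact: le_gamma.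
- by apply: (rule_rec IH1 IH2); apply: le_gamma; rewrite -plus_of_gamma.
- by apply: (rule_inv IH); [exact: gamma_mono | exact: le_gamma].
- have basis_hs b : im_basis b -> alpha b <= abs_join alpha gamma (range hs) ->
      exists i, b <= gamma (hs i).
    move=> Bb /dhs [|i bi]; first by exists b.
    by exists i; exact: le_gamma.
  apply: (rule_join (hs := fun i => gamma (hs i)) (ks := fun i => gamma (ks i))) => //.
  + move=> b Bb bhs; apply: basis_hs => //; apply: alpha_le.
    by rewrite /abs_join gamma_range; apply: (le_trans bhs); exact: le_gamma.
  (* Since [gamma] need not preserve joins, this is tested on basis elements, each caught by one
     [gamma (hs i)] through density. *)
  + apply: basis_le => b Bb bh.
    have [|i bi] := basis_hs b Bb; first by apply: le_trans hhs; exact: alpha_le.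
    by apply: (le_trans bi); apply: join_ub; exists i.
  + by apply: le_gamma; rewrite -gamma_range.
- apply: (rule_meet (hs := fun i => gamma (hs i)) (ks := fun i => gamma (ks i))) => //.
  + apply: meet_glb => _ [i _ <-]; apply: gamma_mono; apply: (le_trans hhs).
    by apply: alpha_le; apply: meet_lb; exists (hs i) => //; exists i.
  + by apply: le_gamma; rewrite -gamma_range.
Qed.

End Concretization.
End InterpMonoidTheory.

Theorem theorem4p3 (d d' : Order.disp_t) (D : interpMonoid d)
    (A : porderType d') (alpha : D -> A) (gamma : A -> D)
    (E : Type) (esem : E -> D -> D)
    (Hesem : valid_esem esem) (Hgalois : galois_insertion alpha gamma)
    (a b : A) (r : Reg E)
    (Hder : appl_abs alpha gamma esem a r b) :
  (sem esem r (gamma a) <= gamma b) /\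
  appl esem (gamma a) r (gamma b).
Proof.
have der := appl_abs_gamma Hgalois _ _ _ Hder.
by split => //; apply: appl_sound Hesem _ _ _ der.
Qed.
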